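(* Let $\mathcal{H}$ be a real Hilbert space, $f:\mathcal{H}\to\mathbb{R}$ a convex function with $\operatorname{argmin} f\neq\emptyset$, $\tilde f:\mathcal{H}\times[0,\infty)\to\mathbb{R}$ a smoothing function of $f$ (in the sense of the context), $\alpha>3$, $t_0>0$, and let $\mu:[0,\infty)\to[0,\infty)$ be continuously differentiable and strictly decreasing with $\lim_{t\to\infty}\mu(t)=0$ and $\int_{t_0}^\infty t\mu(t)\,dt<\infty$. Let $x:[t_0,\infty)\to\mathcal{H}$ be a trajectory of $$\ddot x(t)+\frac{\alpha}{t}\dot x(t)+\nabla_x\tilde f(x(t),\mu(t))=0,\qquad t\ge t_0.$$ Then $x(t)$ converges weakly in $\mathcal{H}$, as $t\to\infty$, to a point of $\operatorname{argmin} f$.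
   Context: A function $\tilde f:\mathcal{H}\times[0,\infty)\to\mathbb{R}$ is called a smoothing function of the convex function $f:\mathcal{H}\to\mathbb{R}$ if: (i) for each fixed $\mu>0$, $\tilde f(\cdot,\mu)$ is continuously differentiable on $\mathcal{H}$, and for each fixed $x\in\mathcal{H}$, $\tilde f(x,\cdot)$ is continuously differentiable on $(0,\infty)$; (ii) $\lim_{z\to x,\ \mu\downarrow 0}\tilde f(z,\mu)=f(x)$ for all $x\in\mathcal{H}$; (iii) $\tilde f(\cdot,\mu)$ is convex on $\mathcal{H}$ for each fixed $\mu>0$; (iv) there is a constant $\kappa>0$ with $|\nabla_\mu\tilde f(x,\mu)|\le\kappa$ for all $\mu\in(0,\infty)$, $x\in\mathcal{H}$; (v) there is a constant $L>0$ such that for every $\mu\in(0,\infty)$, $\nabla_x\tilde f(\cdot,\mu)$ is Lipschitz continuous on $\mathcal{H}$ with constant $L\mu^{-1}$; (vi) for each fixed $z\in\mathcal{H}$, $\mu\mapsto\nabla_z\tilde f(z,\mu)$ is continuous on $(0,\infty)$. Here $\nabla_x\tilde f$ and $\nabla_\mu\tilde f$ denote the gradient in the first variable and the derivative in the second variable. A trajectory is a twice continuously differentiable function $x:[t_0,\infty)\to\mathcal{H}$ satisfying the differential equation for all $t\ge t_0$ (one-sided derivatives at $t_0$). Since $\mu$ is strictly decreasing with limit $0$, one has $\mu(t)>0$ for all $t\geq 0$. *)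

(* Defs.v *)
From HB Require Import structures.
From mathcomp Require Import all_boot all_order all_algebra.
From mathcomp Require Import all_classical all_reals all_analysis.

Set Implicit Arguments.
Unset Strict Implicit.
Unset Printing Implicit Defensive.

Import Order.TTheory GRing.Theory Num.Theory.
Import numFieldNormedType.Exports.

Local Open Scope classical_set_scope.
Local Open Scope ring_scope.

(* A positive definite symmetric bilinear form [dot] makes a complete normed
   space a real Hilbert space when it induces the norm. *)
Definition induces_norm (R : realType) (H : completeNormedModType R)
    (dot : {dot H for idfun}) : Prop :=
  forall u : H, dot u u = `|u| ^+ 2.

(* The Riesz representative of the Frechet differential; meaningful at the
   points where [g] is differentiable. *)
Definition gradient (R : realType) (H : completeNormedModType R)
    (dot : {dot H for idfun}) (g : H -> R) (x : H) : H :=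
  get [set v : H | forall h : H, 'd g x h = dot v h].

Definition C1_gradient (R : realType) (H : completeNormedModType R)
    (dot : {dot H for idfun}) (g : H -> R) : Prop :=
  (forall x : H, differentiable g x) /\ continuous (gradient dot g).

(* The values of [ft] on nonpositive parameters play no role. *)
Record smoothing_function (R : realType) (H : completeNormedModType R)
    (dot : {dot H for idfun}) (f : H -> R) (ft : H -> R -> R) : Prop := {
  smoothing_C1_space : forall m : R, 0 < m -> C1_gradient dot (ft^~ m);
  smoothing_C1_param : forall (x : H) (m : R), 0 < m ->
    derivable (ft x) m 1 /\ {for m, continuous (derive1 (ft x))};
  smoothing_cvg : forall x : H,
    ft p.1 p.2 @[p --> filter_prod (nbhs x) (0 : R)^'+] --> f x;
  smoothing_convex : forall m : R, 0 < m -> convex_function setT (ft^~ m);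
  smoothing_param_bound : exists2 kappa : R, 0 < kappa &
    forall (x : H) (m : R), 0 < m -> `|derive1 (ft x) m| <= kappa;
  smoothing_lipschitz : exists2 L : R, 0 < L &
    forall m : R, 0 < m -> (L * m^-1).-lipschitz (gradient dot (ft^~ m));
  smoothing_gradient_param : forall (z : H) (m : R), 0 < m ->
    {for m, continuous (fun s : R => gradient dot (ft^~ s) z)}
}.

(* Derivative of a map on the half-line [a, +oo[: increments are restricted to
   those that stay in it, so this is the right derivative at [a] and the usual
   derivative beyond. *)
Definition halfline_quotient (R : realType) (V : normedModType R) (a : R)
    (u : R -> V) (t : R) : set_system V :=
  h^-1 *: (u (t + h) - u t) @[h --> within [set h | a <= t + h] (0 : R)^'].

Definition halfline_derive (R : realType) (V : normedModType R) (a : R)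
    (u : R -> V) (t : R) : V :=
  lim (halfline_quotient a u t).

Definition halfline_C1 (R : realType) (V : normedModType R) (a : R)
    (u : R -> V) : Prop :=
  (forall t : R, a <= t -> cvg (halfline_quotient a u t)) /\
  {within `[a, +oo[, continuous (halfline_derive a u)}.

Definition halfline_C2 (R : realType) (V : normedModType R) (a : R)
    (u : R -> V) : Prop :=
  halfline_C1 a u /\ halfline_C1 a (halfline_derive a u).

Definition trajectory (R : realType) (H : completeNormedModType R)
    (dot : {dot H for idfun}) (ft : H -> R -> R) (mu : R -> R)
    (alpha t0 : R) (x : R -> H) : Prop :=
  halfline_C2 t0 x /\
  forall t : R, t0 <= t ->
    halfline_derive t0 (halfline_derive t0 x) t
    + (alpha / t) *: halfline_derive t0 x t
    + gradient dot (ft^~ (mu t)) (x t) = 0.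

Definition argmin (R : realType) (T : Type) (f : T -> R) : set T :=
  [set z | forall y : T, f z <= f y].

(* Convergence at infinity in the topology induced by the continuous dual. *)
Definition weakly_cvg_pinfty (R : realType) (V : normedModType R)
    (x : R -> V) (l : V) : Prop :=
  forall phi : {linear V -> R}, continuous phi ->
    phi (x t) @[t --> +oo] --> phi l.

(* Main.v *)
(* Fix z in argmin f, let kappa bound the parameter derivative of ft, and put
   g(t) = ft(x(t), mu(t)) + kappa mu(t) - f(z), which dominates f(x(t)) - f(z).
   For lam in [2, alpha - 1] the energy
     E_lam = t^2 g + t^2 |x'|^2 / 2
             + lam ((alpha - 1) |x - z|^2 / 2 + t <x - z, x'>)
   is nonnegative and E_lam' <= 2 lam kappa t mu(t), which is integrable; hence
   E_lam converges.  The two values lam = 2 and lam = alpha - 1 show that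
   (alpha - 1) h + t h' converges for h = |x - z|^2 / 2; multiplied by
   t^(alpha - 2) it is the derivative of t^(alpha - 1) h, hence h converges.  Also
   t^2 g <= E_2 gives f(x(t)) -> f(z), so weak cluster points of x are minimisers,
   and Opial's argument concludes. *)
Require Import Defs.
From mathcomp Require Import all_boot all_order all_algebra.
From mathcomp Require Import all_classical all_reals all_analysis.
From mathcomp Require Import ring lra.

Set Implicit Arguments.
Unset Strict Implicit.
Unset Printing Implicit Defensive.

Import Order.TTheory GRing.Theory Num.Theory.
Import numFieldNormedType.Exports.

Local Open Scope classical_set_scope.
Local Open Scope ring_scope.

(** * Limits along filters *)

Lemma cvg_dist_le (R : realType) (V : normedModType R) T (F : set_system T)
    {FF : Filter F} (g : T -> V) (l : V) (h : T -> R) :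
  (\forall t \near F, `|g t - l| <= h t) -> h t @[t --> F] --> 0 ->
  g t @[t --> F] --> l.
Proof.
move=> gh h0; apply/cvgrPdist_lt => e e0.
move/cvgr0Pnorm_lt : h0 => /(_ _ e0) h0.
near=> t; rewrite distrC (@le_lt_trans _ _ (h t))//; first by near: t.
by rewrite (le_lt_trans (ler_norm _))//; near: t.
Unshelve. all: by end_near. Qed.

Lemma cvg_dist0 (R : realType) (V : normedModType R) T (F : set_system T)
    {FF : Filter F} (g : T -> V) (l : V) :
  g t @[t --> F] --> l -> `|g t - l| @[t --> F] --> 0.
Proof.
move=> gl; apply/cvgrPdist_lt => e e0; move/cvgrPdist_lt : gl => /(_ _ e0).
by apply: filterS => t; rewrite sub0r normrN normr_id distrC.
Qed.

Lemma limr_ge_near (R : realType) T (F : set_system T) {FF : ProperFilter F}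
    (g : T -> R) (m l : R) :
  g t @[t --> F] --> l -> (\forall t \near F, m <= g t) -> m <= l.
Proof.
move=> gl mg; rewrite -(cvg_lim (@Rhausdorff R) gl).
by apply: limr_ge => //; apply/cvg_ex; exists l.
Qed.

Lemma limr_le_near (R : realType) T (F : set_system T) {FF : ProperFilter F}
    (g : T -> R) (m l : R) :
  g t @[t --> F] --> l -> (\forall t \near F, g t <= m) -> l <= m.
Proof.
move=> /cvgN gl gm; rewrite -lerN2; apply: (limr_ge_near gl).
by apply: filterS gm => t; rewrite /= lerN2.
Qed.

(** * Real Hilbert spaces *)

Section real_inner_product.
Context {R : realType} {H : completeNormedModType R}.
Context {dot : {dot H for idfun}} (dot_norm : induces_norm dot).
Implicit Types u v w : H.

Lemma dotC u v : dot u v = dot v u.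
Proof. by rewrite hermC /= expr0 mul1r. Qed.

Lemma dotDr u v w : dot u (v + w) = dot u v + dot u w.
Proof. exact: linearDr. Qed.

Lemma dotDl u v w : dot (u + v) w = dot u w + dot v w.
Proof. by rewrite dotC dotDr !(dotC w). Qed.

Lemma dotZr (a : R) u v : dot u (a *: v) = a * dot u v.
Proof. exact: linearZr_LR. Qed.

Lemma dotZl (a : R) u v : dot (a *: u) v = a * dot u v.
Proof. by rewrite dotC dotZr dotC. Qed.

Lemma dotNr u v : dot u (- v) = - dot u v.
Proof. exact: linearNr. Qed.

Lemma dotNl u v : dot (- u) v = - dot u v.
Proof. by rewrite dotC dotNr dotC. Qed.

Lemma dotBr u v w : dot u (v - w) = dot u v - dot u w.
Proof. by rewrite dotDr dotNr. Qed.

Lemma dotBl u v w : dot (u - v) w = dot u w - dot v w.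
Proof. by rewrite dotDl dotNl. Qed.

Definition dotE := (dotDl, dotDr, dotNl, dotNr, dotZl, dotZr).

Lemma dot_ge0 u : 0 <= dot u u.
Proof. by rewrite dot_norm sqr_ge0. Qed.

Lemma cauchy_schwarz u v : `|dot u v| <= `|u| * `|v|.
Proof.
have [->|v0] := eqVneq v 0; first by rewrite linear0r normr0 normr0 mulr0.
have nv0 : 0 < `|v| by rewrite normr_gt0.
rewrite -(@ler_pXn2r _ 2) ?nnegrE ?mulr_ge0//.
rewrite real_normK ?num_real// exprMn -2!dot_norm.
have vv0 : 0 < dot v v by rewrite dot_norm exprn_gt0.
(* This vector is [dot v v] times the component of [u] orthogonal to [v]; its square norm is [dot v
   v * (dot v v * dot u u - dot u v ^+ 2)]. *)
have := dot_ge0 (dot v v *: u - dot u v *: v).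
rewrite !dotE (dotC v u) => h.
rewrite -(ler_pM2r vv0); nra.
Qed.

Lemma cvg_dot T (F : set_system T) {FF : Filter F} (u v : T -> H) (a b : H) :
  u t @[t --> F] --> a -> v t @[t --> F] --> b ->
  dot (u t) (v t) @[t --> F] --> dot a b.
Proof.
move=> ua vb; apply: (cvg_dist_le (h :=
  (fun t => `|u t - a| * `|v t| + `|a| * `|v t - b|))).
  apply: nearW => t.
  have -> : dot (u t) (v t) - dot a b = dot (u t - a) (v t) + dot a (v t - b).
    by rewrite !dotE; ring.
  by rewrite (le_trans (ler_normD _ _))// lerD// cauchy_schwarz.
have -> : 0 = 0 * `|b| + `|a| * 0 :> R by rewrite mul0r mulr0 addr0.
apply: cvgD; apply: cvgM; [|exact: cvg_norm|exact: cvg_cst|].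
  exact: cvg_dist0.
exact: cvg_dist0.
Qed.

Lemma parallelogram u v :
  dot (u - v) (u - v) = 2 * dot u u + 2 * dot v v -
    4 * dot (2^-1 *: (u + v)) (2^-1 *: (u + v)).
Proof. by rewrite !dotE (dotC v u); field. Qed.

(* The representative is the limit of the minimising filter of
   [v |-> |v|^2 - 2 phi v], which is Cauchy by the parallelogram law. *)
Lemma riesz (phi : H -> R) (C : R) :
  {morph phi : u v / u + v} -> (forall a, {morph phi : u / a *: u >-> a * u}) ->
  (forall u, `|phi u| <= C * `|u|) ->
  exists w, forall h, phi h = dot w h.
Proof.
move=> phiD phiZ phiC.
pose J v := dot v v - 2 * phi v.
have J_ge v : - C ^+ 2 <= J v.
  have /ler_normlP[_ h] := phiC v.
  rewrite /J dot_norm; have := sqr_ge0 (`|v| - C); nra.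
have J_inf : has_inf (range J).
  by split; [exists (J 0), 0|exists (- C ^+ 2) => _ [v _ <-]].
set d := inf (range J).
have dJ v : d <= J v by apply: ge_inf; [case: J_inf|exists v].
(* The linear terms of [J] cancel in the parallelogram law, and [J] at the midpoint is at least
   [d]. *)
have J_mid u v : dot (u - v) (u - v) <= 2 * J u + 2 * J v - 4 * d.
  have := dJ (2^-1 *: (u + v)); rewrite parallelogram /J phiZ phiD; lra.
pose F := filter_from [set e : R | 0 < e] (fun e => [set v | J v < d + e]).
have FF : ProperFilter F.
  apply: filter_from_proper; last first.
    by move=> e e0; have [_ [v _ <-] Jv] := inf_adherent e0 J_inf; exists v.
  apply: filter_from_filter; first by exists 1 => /=.
  move=> e e' /= e0 e'0; exists (Num.min e e') => /=; first by rewrite lt_min e0.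
  move=> v /= Jv; split => /=; apply: (lt_le_trans Jv); rewrite lerD2l.
    by rewrite ge_min lexx.
  by rewrite ge_min lexx orbT.
have Fcvg : cvg F.
  apply: cauchy_cvg; apply: cauchy_exP => e /= e0.
  (* By [J_mid], two points where [J] is below [d + e ^+ 2 / 4] are at distance less than [e]. *)
  have d0 : 0 < e ^+ 2 / 4 by rewrite divr_gt0// exprn_gt0.
  have [_ [u _ <-] Ju] := inf_adherent d0 J_inf.
  exists u; exists (e ^+ 2 / 4) => // v /= Jv.
  have uv : `|u - v| ^+ 2 < e ^+ 2.
    rewrite -dot_norm; apply: le_lt_trans (J_mid _ _) _; lra.
  rewrite -ball_normE/=.
  have [eu|//] := leP e `|u - v|.
  by have := lt_le_trans uv (lerXn2r 2 (ltW e0) (normr_ge0 _) eu); rewrite ltxx.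
exists (lim F) => h; set w := lim F.
have Fdot : dot v h @[v --> F] --> dot w h.
  by apply: cvg_dot => //; exact: cvg_cst.
(* First variation at [w]: the limit along [F] of [d <= J (v + s *: h)], where [J v < d + e]. *)
have var (s : R) : 0 <= 2 * s * (dot w h - phi h) + s ^+ 2 * dot h h.
  rewrite -[leRHS]addr0; apply/ler_addgt0Pr => e e0; rewrite addr0.
  have : (fun v => 2 * s * (dot v h - phi h) + s ^+ 2 * dot h h + e) v @[v --> F]
      --> 2 * s * (dot w h - phi h) + s ^+ 2 * dot h h + e.
    apply: cvgD; last exact: cvg_cst.
    apply: cvgD; last exact: cvg_cst.
    apply: cvgM; first exact: cvg_cst.
    by apply: cvgB => //; exact: cvg_cst.
  move=> /limr_ge_near; apply.
  exists e => // v /= Jv.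
  have := dJ (v + s *: h); move: Jv; rewrite /J !dotE phiD phiZ (dotC h v); lra.
set c := dot w h - phi h in var.
have h0 := dot_ge0 h.
have h1 : dot h h + 1 != 0 by rewrite gt_eqF// ltr_wpDl.
(* This choice of [s] makes the variation a nonpositive multiple of [c ^+ 2], so [c = 0]; the [+ 1]
   covers [h = 0]. *)
have := var (- c / (dot h h + 1)).
have -> : 2 * (- c / (dot h h + 1)) * c + (- c / (dot h h + 1)) ^+ 2 * dot h h =
   - (c ^+ 2 * (dot h h + 2)) / (dot h h + 1) ^+ 2 by field.
rewrite pmulr_lge0 ?invr_gt0 ?exprn_gt0 ?ltr_wpDl// oppr_ge0.
rewrite pmulr_lle0 ?ltr_wpDl// => c2.
have /eqP : c ^+ 2 == 0 by rewrite eq_le c2 sqr_ge0.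
by move=> /eqP; rewrite sqrf_eq0 subr_eq0 => /eqP.
Qed.

End real_inner_product.

(** * Riesz representation of differentials and the gradient inequality *)

Section gradients.
Context {R : realType} {H : completeNormedModType R}.
Context {dot : {dot H for idfun}} (dot_norm : induces_norm dot).

Lemma riesz_continuous (phi : {linear H -> R}) :
  continuous phi -> exists w, forall h, phi h = dot w h.
Proof.
move=> /linear_bounded_continuous/linear_boundedP/pinfty_ex_gt0[C _ phiC].
by apply: (riesz dot_norm (C := C)) => //; [exact: linearD|exact: linearZ_LR].
Qed.

(** [gradient] is a [get], so its defining equation needs a representative to exist; Riesz applied
    to the continuous differential supplies one. *)
Lemma diff_gradient (g : H -> R) (a h : H) :
  differentiable g a -> 'd g a h = dot (gradient dot g a) h.
Proof.
move=> dg; have [w wE] := riesz_continuous (diff_continuous dg).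
by have /getPex -> : exists v : H, forall h, 'd g a h = dot v h by exists w.
Qed.

(** The left side is the limit of the right difference quotients at [a] in the direction [b - a],
    and convexity bounds each of them, for steps in []0, 1[], by [g b - g a]. *)
Lemma convex_gradient_le (g : H -> R) (a b : H) :
  convex_function setT g -> differentiable g a ->
  dot (gradient dot g a) (b - a) <= g b - g a.
Proof.
move=> cg dg; rewrite -diff_gradient// -deriveE//.
have dcvg : h^-1 *: (g (h *: (b - a) + a) - g a) @[h --> 0^'+] --> 'D_(b - a) g a.
  by apply: cvg_dnbhs_at_right; exact: (diff_derivable dg).
apply: (limr_le_near dcvg); near=> h.
have h0 : 0 < h by near: h; exact: nbhs_right_gt.
have h1 : h < 1 by near: h; exact: nbhs_right_lt.
have := cg (Itv01 (ltW h0) (ltW h1)) b a; rewrite !inE => /(_ I I).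
rewrite convRE /= /unstable.onem.
have -> : @conv R (convex_lmodType H) (Itv01 (ltW h0) (ltW h1)) b a = h *: (b - a) + a.
  rewrite /conv /= /unstable.onem scalerBl scale1r scalerBr.
  by rewrite addrCA addrC.
move=> gh; rewrite -[leLHS]/(h^-1 * _) ler_pdivrMl//; lra.
Unshelve. all: by end_near. Qed.

End gradients.

(** * Derivatives in one real variable as limits of difference quotients *)

Lemma is_derive1P (R : realType) (V : normedModType R) (u : R -> V) (t : R) (v : V) :
  h^-1 *: (u (t + h) - u t) @[h --> 0^'] --> v -> is_derive t 1 u v.
Proof.
move=> uv; have E : (fun h => h^-1 *: (u (t + h) - u t)) =
    (fun h => h^-1 *: ((u \o shift t) (h *: 1) - u t)).
  by apply/funext => h /=; rewrite -[h *: 1]/(h * 1) mulr1 (addrC h).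
by rewrite E in uv; split; [apply/cvg_ex; exists v|exact/cvg_lim].
Qed.

Lemma is_derive1_cvg (R : realType) (V : normedModType R) (u : R -> V) (t : R) (v : V) :
  is_derive t 1 u v -> h^-1 *: (u (t + h) - u t) @[h --> 0^'] --> v.
Proof.
case=> du uv; have E : (fun h => h^-1 *: (u (t + h) - u t)) =
    (fun h => h^-1 *: ((u \o shift t) (h *: 1) - u t)).
  by apply/funext => h /=; rewrite -[h *: 1]/(h * 1) mulr1 (addrC h).
by rewrite E -uv; exact: du.
Qed.

Lemma is_derive1_cvg_shift (R : realType) (V : normedModType R) (u : R -> V)
    (t : R) (v : V) :
  is_derive t 1 u v -> u (t + h) @[h --> 0^'] --> u t.
Proof.
move=> du; have := is_derive1_cvg du.
have h0 : (h : R) @[h --> 0^'] --> (0 : R) by exact: cvg_within.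
move=> /(cvgZ h0); rewrite scale0r => /(cvgD (cvg_cst (u t))) /=; rewrite addr0.
apply: cvg_trans; apply: near_eq_cvg; near=> h.
have hn0 : h != 0 by near: h; exact: nbhs_dnbhs_neq.
by rewrite fctE /= scalerA divff// scale1r subrKC.
Unshelve. all: by end_near. Qed.

(** * Smoothing functions *)

Section smoothing.
Context {R : realType} {H : completeNormedModType R}.
Context {dot : {dot H for idfun}} (dot_norm : induces_norm dot).
Context {f : H -> R} {ft : H -> R -> R} (smooth : smoothing_function dot f ft).

(** The mean value theorem in the parameter gives the bound on [[s, m]]; then [s] tends to [0] from
    the right with [x] fixed. *)
Lemma smoothing_dist_le (kappa : R) :
  (forall (x : H) (m : R), 0 < m -> `|derive1 (ft x) m| <= kappa) ->
  forall (x : H) (m : R), 0 < m -> `|ft x m - f x| <= kappa * m.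
Proof.
move=> kappaP x m m0.
have k0 : 0 <= kappa by apply: le_trans (kappaP x m m0).
have cv : ft x s @[s --> (0 : R)^'+] --> f x.
  have pc : (x, s) @[s --> (0 : R)^'+] --> filter_prod (nbhs x) (0 : R)^'+.
    by move=> A [[B C] /= [Bx C0] BCA]; apply: filterS C0 => s Cs;
       apply: BCA; split => //; exact: nbhs_singleton.
  exact: (cvg_comp _ _ pc (smoothing_cvg smooth (x := x))).
have : `|ft x m - ft x s| @[s --> (0 : R)^'+] --> `|ft x m - f x|.
  by apply: cvg_norm; apply: cvgB cv; exact: cvg_cst.
move=> /limr_le_near; apply; near=> s.
have s0 : 0 < s by near: s; exact: nbhs_right_gt.
have sm : s <= m by near: s; exact: nbhs_right_le.
have dft r : 0 < r -> derivable (ft x) r 1.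
  by move=> r0; have [] := smoothing_C1_param smooth x r0.
have D r : r \in `]s, m[ -> is_derive r 1 (ft x) (derive1 (ft x) r).
  rewrite in_itv /= => /andP[sr _].
  by rewrite derive1E; apply: derivableP; apply: dft; exact: lt_trans sr.
have C : {within `[s, m], continuous (ft x)}.
  apply: derivable_within_continuous => r; rewrite in_itv /= => /andP[sr _].
  by apply: dft; exact: lt_le_trans sr.
have [r + ->] := MVT_segment sm D C; rewrite in_itv /= => /andP[sr _].
rewrite normrM ler_pM//; first by apply: kappaP; exact: lt_le_trans sr.
by rewrite ger0_norm ?subr_ge0// gerBl ltW.
Unshelve. all: by end_near. Qed.

(* Using convexity at both endpoints avoids integrating the gradient along the
   segment, at the cost of a factor 2 in the constant. *)
Lemma smoothing_expansion (L m : R) (a b : H) : 0 < m ->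
  (L * m^-1).-lipschitz (gradient dot (ft^~ m)) ->
  `|ft b m - ft a m - dot (gradient dot (ft^~ m) a) (b - a)|
    <= L * m^-1 * `|b - a| ^+ 2.
Proof.
move=> m0 lip; have [dft _] := smoothing_C1_space smooth m0.
have cft := smoothing_convex smooth m0.
have ab := convex_gradient_le dot_norm b cft (dft a).
have ba := convex_gradient_le dot_norm a cft (dft b).
have := lip (b, a) (conj I I); rewrite /= => gab.
have cs := le_trans (ler_norm _) (cauchy_schwarz dot_norm
  (gradient dot (ft^~ m) b - gradient dot (ft^~ m) a) (b - a)).
rewrite ger0_norm ?subr_ge0//.
have gab' : `|gradient dot (ft^~ m) b - gradient dot (ft^~ m) a| * `|b - a| <=
    L * m^-1 * `|b - a| ^+ 2.
  by rewrite expr2 mulrA ler_wpM2r.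
rewrite -(opprB b a) dotNr lerNl opprB in ba; rewrite dotBl in cs.
exact: le_trans (lerB ba (lexx _)) (le_trans cs gab').
Qed.

(* [ft] is not assumed jointly differentiable: the increment in space is expanded
   at the parameter [mu (t + h)], where the Lipschitz constant of the gradient
   remains bounded. *)
Lemma smoothing_is_derive (x : R -> H) (mu : R -> R) (t m' : R) (x' : H) :
  is_derive t 1 x x' -> is_derive t 1 mu m' -> 0 < mu t ->
  is_derive t 1 (fun s => ft (x s) (mu s))
    (dot (gradient dot (ft^~ (mu t)) (x t)) x' + m' * derive1 (ft (x t)) (mu t)).
Proof.
move=> dx dmu mut0; apply: is_derive1P.
have [L L0 lip] := smoothing_lipschitz smooth.
have xc := is_derive1_cvg_shift dx.
have muc := is_derive1_cvg_shift dmu.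
have -> : (fun h => h^-1 *: (ft (x (t + h)) (mu (t + h)) - ft (x t) (mu t))) =
  (fun h => h^-1 *: (ft (x (t + h)) (mu (t + h)) - ft (x t) (mu (t + h)))) +
  (fun h => h^-1 *: (ft (x t) (mu (t + h)) - ft (x t) (mu t))).
  by apply/funext => h; rewrite fctE -scalerDr addrA subrK.
apply: cvgD; last first.
  apply: (@is_derive1_cvg _ _ (ft (x t) \o mu)).
  rewrite mulrC; apply: is_derive1_comp.
  have [dft _] := smoothing_C1_param smooth (x t) mut0.
  by split => //; rewrite derive1E.
(* The base point stays at [x t] and only the parameter moves, so continuity of the gradient in the
   parameter gives the limit of [G]. *)
pose G h := gradient dot (ft^~ (mu (t + h))) (x t).
pose D h := h^-1 *: (x (t + h) - x t).
have Dc : D h @[h --> 0^'] --> x' by exact: is_derive1_cvg.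
have Gc : G h @[h --> 0^'] --> gradient dot (ft^~ (mu t)) (x t).
  exact: (cvg_comp _ _ muc (smoothing_gradient_param smooth (z := x t) mut0)).
(* The quadratic remainder of [smoothing_expansion], divided by [h]: one factor of the square
   becomes [D h], which converges, and the other tends to [0]. *)
have Ec : L * (mu (t + h))^-1 * (`|D h| * `|x (t + h) - x t|) @[h --> 0^'] --> 0.
  have muVc : (mu (t + h))^-1 @[h --> 0^'] --> (mu t)^-1.
    by apply: cvgV => //; exact: lt0r_neq0.
  rewrite -[X in _ --> X](mulr0 (L * (mu t)^-1 * `|x'|)) -mulrA.
  apply: cvgM; first by apply: cvgM => //; exact: cvg_cst.
  by apply: cvgM; [exact: cvg_norm|exact: cvg_dist0].
have DGc : dot (G h) (D h) @[h --> 0^'] --> dot (gradient dot (ft^~ (mu t)) (x t)) x'.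
  exact: cvg_dot.
apply: (cvg_dist_le (h := fun h => L * (mu (t + h))^-1 * (`|D h| * `|x (t + h) - x t|)
   + `|dot (G h) (D h) - dot (gradient dot (ft^~ (mu t)) (x t)) x'|)); last first.
  by rewrite -[X in _ --> X]addr0; apply: cvgD => //; exact: cvg_dist0.
near=> h.
have mh0 : 0 < mu (t + h) by near: h; exact: (cvgr_gt _ muc).
apply: (le_trans (ler_distD (dot (G h) (D h)) _ _)); rewrite lerD2r.
rewrite dotZr -mulrBr normrM /D normrZ.
rewrite [leRHS](_ : _ =
  `|h^-1| * (L * (mu (t + h))^-1 * `|x (t + h) - x t| ^+ 2)); last by ring.
by rewrite ler_wpM2l// smoothing_expansion//; exact: lip.
Unshelve. all: by end_near. Qed.

End smoothing.

(** * Asymptotics of real functions *)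

(** For [t] beyond [a], every small increment stays in the half-line, so restricting the increments
    changes nothing. *)
Lemma halfline_is_derive (R : realType) (V : normedModType R) (a t : R) (u : R -> V) :
  halfline_C1 a u -> a < t -> is_derive t 1 u (halfline_derive a u t).
Proof.
move=> [du _] at0; apply: is_derive1P => A /(du _ (ltW at0)).
have nt : \forall h \near (0 : R)^', a <= t + h.
  have h0 : (h : R) @[h --> 0^'] --> (0 : R) by exact: cvg_within.
  near=> h; rewrite -lerBlDl; near: h; apply: (cvgr_ge _ h0).
  by rewrite subr_lt0.
rewrite /within /= => HA; move: nt HA; rewrite !nbhs_simpl /=.
by apply: filterS2 => h ha; apply.
Unshelve. all: by end_near. Qed.

Lemma derive_le0_nonincreasing (R : realType) (g g' : R -> R) (a : R) :
  (forall t, a < t -> is_derive t 1 g (g' t)) -> (forall t, a < t -> g' t <= 0) ->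
  forall s t, a < s -> s <= t -> g t <= g s.
Proof.
move=> dg g'0 s t as0 st.
have D r : r \in `]s, t[ -> is_derive r 1 g (g' r).
  by rewrite in_itv /= => /andP[sr _]; apply: dg; exact: lt_trans sr.
have C : {within `[s, t], continuous g}.
  apply: derivable_within_continuous => r; rewrite in_itv /= => /andP[sr _].
  by have [] := dg _ (lt_le_trans as0 sr).
have [r + E] := MVT_segment st D C; rewrite in_itv /= => /andP[sr _].
rewrite -subr_le0 E; apply: mulr_le0_ge0; last by rewrite subr_ge0.
by apply: g'0; exact: lt_le_trans sr.
Qed.

Lemma nonincreasing_is_cvg_pinfty (R : realType) (g : R -> R) (a m : R) :
  (forall s t, a < s -> s <= t -> g t <= g s) -> (forall t, a < t -> m <= g t) ->
  exists l : R, g t @[t --> +oo] --> l.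
Proof.
(* Freezing the argument below [a + 1] makes the function monotone on the whole line; the sign turns
   it into a bounded nondecreasing one. *)
move=> gdecr mg; pose G t := - g (Num.max (a + 1) t).
have aM t : a < Num.max (a + 1) t by rewrite lt_max ltrDl ltr01.
have Gincr : {homo G : s t / s <= t}.
  move=> s t st; rewrite /G lerN2; apply: gdecr; first exact: aM.
  by rewrite ge_max !le_max lexx /= st orbT.
have Gub : has_ubound (range G).
  by exists (- m) => _ [t _ <-]; rewrite lerN2 mg.
exists (- sup (range G)).
apply: cvg_trans (cvgN (nondecreasing_cvgr Gincr Gub)).
apply: near_eq_cvg; near=> t; rewrite fctE /G opprK; congr g.
by apply/max_idPr; near: t; apply: nbhs_pinfty_ge; rewrite num_real.
Unshelve. all: by end_near. Qed.

(* [E - k * int_b^t s] is nonincreasing. *)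
Lemma quasi_nonincreasing_is_cvg_pinfty (R : realType) (E E' s : R -> R) (b k : R) :
  0 <= k -> (forall t, b < t -> is_derive t 1 E (E' t)) ->
  (forall t, b < t -> E' t <= k * s t) -> (forall t, b < t -> 0 <= E t) ->
  (forall t, b <= t -> 0 <= s t) ->
  (forall t, b < t -> {for t, continuous s}) -> measurable_fun `[b, +oo[ s ->
  (\int[lebesgue_measure]_(t in `[b, +oo[) (s t)%:E < +oo)%E ->
  exists l : R, E t @[t --> +oo] --> l.
Proof.
move=> k0 dE E's E0 s0 cs ms ints.
pose I := (\int[lebesgue_measure]_(t in `[b, +oo[) (s t)%:E)%E.
have sub (u : R) : `[b, u] `<=` (`[b, +oo[ : set R).
  by move=> t /=; rewrite !in_itv /= andbT => /andP[].
have s0E (D : set R) : D `<=` `[b, +oo[ -> forall t, D t -> (0 <= (s t)%:E)%E.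
  by move=> DD t /DD /=; rewrite in_itv/= andbT lee_fin => /s0.
have int_le u : (\int[lebesgue_measure]_(t in `[b, u]) (s t)%:E <= I)%E.
  apply: ge0_subset_integral => //; first exact/measurable_realfun.measurable_EFinP.
  exact: s0E.
have int_ge0 u : (0 <= \int[lebesgue_measure]_(t in `[b, u]) (s t)%:E)%E.
  by apply: integral_ge0; exact: s0E.
have integ u : lebesgue_measure.-integrable `[b, u] (EFin \o s).
  apply/integrableP; split.
    by apply/measurable_realfun.measurable_EFinP; exact: measurable_funS (sub u) ms.
  rewrite (le_lt_trans _ ints)// (le_trans _ (int_le u))//.
  under eq_integral => t tu.
    rewrite /= ger0_norm; last first.
      by apply: s0; move/set_mem/sub : tu; rewrite /= in_itv/= andbT.
    over.
  by [].
pose G u := Rintegral lebesgue_measure `[b, u] s.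
have dG u : b < u -> is_derive u 1 G (s u).
  move=> bu; have u1 : u < u + 1 by rewrite ltrDl.
  have [dG <-] := continuous_FTC1_closed u1 (integ (u + 1)) bu (cs u bu).
  by rewrite derive1E; exact: derivableP.
have Ifin : I \is a fin_num.
  by rewrite ge0_fin_numE//; apply: integral_ge0; exact: s0E.
have G_le u : G u <= fine I.
  by apply: fine_le => //; rewrite ge0_fin_numE// (le_lt_trans (int_le u)).
(* [E] is recovered as [(E - k * G) + k * G]. Here [G] converges, being nondecreasing and bounded by
   the total integral; that bound and [E >= 0] also bound [E - k * G] from below. *)
have [lG Gl] : exists l : R, - G t @[t --> +oo] --> l.
  apply: (@nonincreasing_is_cvg_pinfty _ (fun t => - G t) b (- fine I)); last first.
    by move=> t _; rewrite lerN2.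
  apply: (@derive_le0_nonincreasing _ _ (fun t => - s t)).
    by move=> t bt; apply: is_deriveN; exact: dG.
  by move=> t bt; rewrite oppr_le0 s0// ltW.
have [lW Wl] : exists l : R, E t - k * G t @[t --> +oo] --> l.
  apply: (@nonincreasing_is_cvg_pinfty _ (fun t => E t - k * G t) b
    (- (k * fine I))); last first.
    by move=> t bt; rewrite -[leLHS]add0r lerB ?E0// ler_wpM2l.
  apply: (@derive_le0_nonincreasing _ _ (fun t => E' t - k * s t)).
    move=> t bt; apply: is_deriveB; first exact: dE.
    by apply: is_deriveZ; exact: dG.
  by move=> t bt; rewrite subr_le0 E's.
exists (lW - k * lG).
have -> : E = (fun t => (E t - k * G t) - k * (- G t)) by apply/funext => t; ring.
by apply: cvgB => //; apply: cvgM => //; exact: cvg_cst.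
Qed.

(* Integrating factor [t^beta]. *)
Lemma linear_ode_limsup (R : realType) (h h' : R -> R) (a beta c e : R) :
  0 < beta -> 0 <= a -> (forall t, a < t -> is_derive t 1 h (h' t)) ->
  (forall t, a < t -> beta * h t + t * h' t <= beta * c) ->
  0 < e -> \forall t \near +oo, h t <= c + e.
Proof.
move=> beta0 a0 dh hc e0.
pose w t := expR (beta * ln t); pose W t := w t * (h t - c).
have dW t : a < t -> is_derive t 1 W (w t * t^-1 * (beta * h t + t * h' t - beta * c)).
  move=> at0; have t0 : 0 < t by exact: le_lt_trans at0.
  have dh' := dh _ at0; have dln := is_derive1_ln t0.
  apply: is_derive_eq; rewrite /GRing.scale /=.
  by rewrite /w; field; rewrite gt_eqF.
have W_decr := derive_le0_nonincreasing dW.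
have {}W_decr s t : a < s -> s <= t -> W t <= W s.
  apply: W_decr => r ar; have r0 : 0 < r by exact: le_lt_trans ar.
  by rewrite mulr_ge0_le0 ?subr_le0 ?hc// mulr_ge0 ?expR_ge0// invr_ge0 ltW.
set T := a + 1; have aT : a < T by rewrite ltrDl.
near=> t.
have Tt : T <= t by near: t; apply: nbhs_pinfty_ge; rewrite num_real.
have t0 : 0 < t by apply: lt_le_trans Tt; exact: le_lt_trans aT.
have := W_decr _ _ aT Tt; rewrite {1}/W -lerBlDl.
have w0 : 0 < w t by exact: expR_gt0.
rewrite mulrC -ler_pdivlMr// => /le_trans; apply.
rewrite ler_pdivrMr//.
(* Monotonicity leaves [h t - c <= W T / w t]. This crude growth of [w] suffices to bring the
   quotient below [e]. *)
have wln : 1 + beta * ln t <= w t by exact: expR_ge1Dx.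
have lnt : W T / e / beta <= ln t.
  rewrite -ler_expR lnK ?posrE//; near: t; apply: nbhs_pinfty_ge; rewrite num_real//.
move: lnt; rewrite ler_pdivrMr// ler_pdivrMr// => lnt; nra.
Unshelve. all: by end_near. Qed.

(** The one-sided bound is applied to both [h] and [- h]; half of [e] pays for replacing the right
    side by its limit, half for the decaying homogeneous solution. *)
Lemma linear_ode_cvg (R : realType) (h h' : R -> R) (a beta l : R) :
  0 < beta -> (forall t, a < t -> is_derive t 1 h (h' t)) ->
  beta * h t + t * h' t @[t --> +oo] --> l -> h t @[t --> +oo] --> l / beta.
Proof.
move=> beta0 dh hl; apply/cvgrPdist_le => e e0.
have be0 : 0 < beta * (e / 2) by rewrite mulr_gt0// divr_gt0.
move/cvgrPdist_le : hl => /(_ _ be0)[b [_ bP]].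
set c := Num.max (Num.max a b) 0.
have cP t : c < t -> [/\ a < t, b < t & 0 < t].
  by rewrite /c !gt_max => /andP[/andP[]].
have c0 : 0 <= c by rewrite le_max lexx orbT.
have e20 : 0 < e / 2 by rewrite divr_gt0.
have up := @linear_ode_limsup _ h h' c beta (l / beta + e / 2) (e / 2) beta0 c0.
have dn := @linear_ode_limsup _ (fun t => - h t) (fun t => - h' t) c beta
  (- (l / beta) + e / 2) (e / 2) beta0 c0.
have El : beta * (l / beta) = l by rewrite mulrC divfK// gt_eqF.
near=> t.
have u1 : h t <= l / beta + e / 2 + e / 2.
  near: t; apply: up => // t /cP[at0 bt _]; first exact: dh.
  by have /ler_normlP[] := bP _ bt; rewrite mulrDr El; lra.
have d1 : - h t <= - (l / beta) + e / 2 + e / 2.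
  near: t; apply: dn => // t /cP[at0 bt _].
    by apply: is_deriveN; exact: dh.
  by have /ler_normlP[] := bP _ bt; rewrite mulrDr !mulrN El; lra.
by apply/ler_normlP; split; clear -u1 d1; lra.
Unshelve. all: by end_near. Qed.

(** * Weak convergence *)

Lemma ultra_compact_cvg (R : realType) T (U : set_system T) (UU : UltraFilter U)
    (g : T -> R) (M : R) :
  U [set t | `|g t| <= M] -> exists l : R, g t @[t --> U] --> l.
Proof.
move=> gM; have := @segment_compact R (- M) M (g @ U).
case.
  suff E : [set t | `|g t| <= M] = g @^-1` `[- M, M] by move: gM; rewrite E.
  by apply/seteqP; split => t /=; rewrite in_itv/= ler_norml.
move=> l [_ lU]; exists l => B lB.
(* An ultrafilter converges to its cluster points: otherwise it contains the preimage of the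
   complement of [B], and clustering yields a point both in and out of [B]. *)
have [//|nB] := in_ultra_setVsetC (g @^-1` B) UU.
have [r [/= nBr Br]] := lU (~` B) B nB lB.
by exfalso.
Qed.

Section weak_convergence.
Context {R : realType} {H : completeNormedModType R}.
Context {dot : {dot H for idfun}} (dot_norm : induces_norm dot).

(** Weak compactness of balls: the limits of [dot (x t) h] exist for each [h], are linear in [h] by
    uniqueness of limits and bounded by [M], hence come from a vector by Riesz. *)
Lemma ultra_weak_cvg T (U : set_system T) (UU : UltraFilter U) (x : T -> H) (M : R) :
  U [set t | `|x t| <= M] ->
  exists u, forall h, dot (x t) h @[t --> U] --> dot u h.
Proof.
move=> xM.
have bound h : U [set t | `|dot (x t) h| <= M * `|h|].
  apply: filterS xM => t /= xM.
  by rewrite (le_trans (cauchy_schwarz dot_norm _ _))// ler_wpM2r.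
have /choice[phi phiP] := fun h => ultra_compact_cvg UU (bound h).
have uniq h l : dot (x t) h @[t --> U] --> l -> l = phi h.
  by move=> hl; exact: (cvg_unique (@Rhausdorff R) hl (phiP h)).
have [u uP] : exists u, forall h, phi h = dot u h.
  apply: (riesz dot_norm (C := M)).
  - move=> v w; apply/esym; apply: uniq.
    have -> : (fun t => dot (x t) (v + w)) = (fun t => dot (x t) v + dot (x t) w).
      by apply/funext => t; rewrite dotDr.
    exact: cvgD.
  - move=> a v; apply/esym; apply: uniq.
    have -> : (fun t => dot (x t) (a *: v)) = (fun t => a * dot (x t) v).
      by apply/funext => t; rewrite dotZr.
    by apply: cvgM => //; exact: cvg_cst.
  - by move=> h; apply: limr_le_near (cvg_norm (phiP h)) (bound h).
by exists u => h; rewrite -uP.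
Qed.

(** Weak cluster points are limits along filters finer than [+oo]. Boundedness provides one along
    each ultrafilter, and convergence of the distances to points of [S] forces any two to
    coincide. *)
Lemma opial (S : set H) (x : R -> H) (M : R) :
  (\forall t \near +oo, `|x t| <= M) ->
  (forall z, S z -> exists l : R, dot (x t - z) (x t - z) @[t --> +oo] --> l) ->
  (forall (U : set_system R) u, ProperFilter U -> +oo `<=` U ->
    (forall h, dot (x t) h @[t --> U] --> dot u h) -> S u) ->
  exists2 xstar, S xstar & weakly_cvg_pinfty x xstar.
Proof.
move=> xM Scvg Sclu.
have ultra_limit (U : set_system R) : UltraFilter U -> +oo `<=` U ->
    exists2 u, S u & forall h, dot (x t) h @[t --> U] --> dot u h.
  move=> UU oU; have [|u uP] := @ultra_weak_cvg _ U UU x M; first exact: oU.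
  by exists u => //; exact: Sclu uP.
have [U [UU oU]] := @ultraFilterLemma R (pinfty_nbhs R) _.
have [u Su uP] := ultra_limit U UU oU.
exists u => // phi /(riesz_continuous dot_norm)[w phiE].
have -> : (fun t => phi (x t)) = (fun t => dot (x t) w).
  by apply/funext => t; rewrite phiE dotC.
rewrite phiE dotC; apply: contrapT => ncvg.
have [B [uB nB]] :
    exists B, nbhs (dot u w) B /\ ~ (\forall t \near +oo, B (dot (x t) w)).
  apply: contrapT => hB; apply: ncvg => B uB; apply: contrapT => nB.
  by apply: hB; exists B.
(* [D] meets every neighbourhood of infinity, so some ultrafilter [V] finer than [+oo] contains it;
   its weak limit [v] will equal [u], contradicting the choice of [B]. *)
pose D := [set t | ~ B (dot (x t) w)].
have FD : ProperFilter (within D (+oo : set_system R)).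
  apply: Build_ProperFilter_ex => A DA.
  apply: contrapT => nA; apply: nB; move: DA; rewrite /within /=.
  apply: filterS => t DA; apply: contrapT => nBt; apply: nA.
  by exists t; exact: DA.
have [V [VU FV]] := ultraFilterLemma FD.
have oV : +oo `<=` V.
  by move=> A oA; apply: FV; move: oA; rewrite /within /=; apply: filterS.
have [v Sv vP] := ultra_limit V VU oV.
have [[lu ul] [lv vl]] := (Scvg u Su, Scvg v Sv).
(* The difference of the two square distances is affine in [x t]. The limit along [+oo] is also the
   one along [U] and [V], so [dot u (u - v) = dot v (u - v)]. *)
have difc : dot (x t) (u - v) @[t --> +oo] --> (lv - lu + (dot u u - dot v v)) / 2.
  have -> : (fun t => dot (x t) (u - v)) = (fun t => (dot (x t - v) (x t - v)
      - dot (x t - u) (x t - u) + (dot u u - dot v v)) / 2).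
    by apply/funext => t; rewrite !dotE (dotC u (x t)) (dotC v (x t)); field.
  exact: (cvgM (cvgD (cvgB vl ul) (cvg_cst _)) (cvg_cst _)).
have uE := cvg_unique (@Rhausdorff R) (uP (u - v)) (cvg_trans (cvg_app _ oU) difc).
have vE := cvg_unique (@Rhausdorff R) (vP (u - v)) (cvg_trans (cvg_app _ oV) difc).
have uv : u = v.
  apply/eqP; rewrite -subr_eq0 -normr_eq0 -sqrf_eq0 -dot_norm dotBl.
  by apply/eqP; rewrite uE vE subrr.
have : V (D `&` [set t | B (dot (x t) w)]).
  apply: filterI; first by apply: FV; rewrite /within /=; exact: nearW.
  by apply: vP; rewrite -uv.
by move=> /filter_ex[t [/= nBt]].
Qed.

End weak_convergence.

(** * Energy of a trajectory *)

Lemma is_derive_dot (R : realType) (H : completeNormedModType R)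
    (dot : {dot H for idfun}) (dot_norm : induces_norm dot)
    (u w : R -> H) (t : R) (u' w' : H) :
  is_derive t 1 u u' -> is_derive t 1 w w' ->
  is_derive t 1 (fun s => dot (u s) (w s)) (dot u' (w t) + dot (u t) w').
Proof.
move=> du dw; apply: is_derive1P.
have wc := is_derive1_cvg_shift dw.
have -> : (fun h => h^-1 *: (dot (u (t + h)) (w (t + h)) - dot (u t) (w t))) =
    (fun h => dot (h^-1 *: (u (t + h) - u t)) (w (t + h)) +
              dot (u t) (h^-1 *: (w (t + h) - w t))).
  by apply/funext => h; rewrite /GRing.scale /= !(dotZl, dotZr) dotBl dotBr; ring.
apply: cvgD; apply: (cvg_dot dot_norm) => //.
- exact: is_derive1_cvg.
- exact: cvg_cst.
- exact: is_derive1_cvg.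
Qed.

Section trajectory_energy.
Context {R : realType} {H : completeNormedModType R}.
Context {dot : {dot H for idfun}} (dot_norm : induces_norm dot).
Context {f : H -> R} {ft : H -> R -> R} (smooth : smoothing_function dot f ft).
Context {alpha t0 : R} (alpha_gt3 : 3 < alpha) (t0_gt0 : 0 < t0).
Context {mu : R -> R} (mu_ge0 : forall t : R, 0 <= t -> 0 <= mu t).
Context (mu_C1 : halfline_C1 0 mu).
Context (mu_decr : forall s t : R, 0 <= s -> s < t -> mu t < mu s).
Context (mu_int : (\int[lebesgue_measure]_(t in `[t0, +oo[) (t * mu t)%:E < +oo)%E).
Context {x : R -> H} (x_traj : trajectory dot ft mu alpha t0 x).
Context {kappa : R} (kappa_gt0 : 0 < kappa).
Context (kappaP : forall (y : H) (m : R), 0 < m -> `|derive1 (ft y) m| <= kappa).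
Context {z : H} (z_min : argmin f z).

Implicit Types t lam e : R.

Local Notation v := (halfline_derive t0 x).
Local Notation mu' := (halfline_derive 0 mu).
Local Notation grad t := (gradient dot (ft^~ (mu t)) (x t)).

(** The term [kappa * mu t] absorbs the smoothing error, and it makes the contribution of [mu'] to
    the derivative nonpositive. *)
Definition gap (t : R) : R := ft (x t) (mu t) + kappa * mu t - f z.

Definition energy (lam t : R) : R :=
  t ^+ 2 * gap t + t ^+ 2 / 2 * dot (v t) (v t)
  + lam * ((alpha - 1) / 2 * dot (x t - z) (x t - z) + t * dot (x t - z) (v t)).

Lemma mu_gt0 t : 0 <= t -> 0 < mu t.
Proof.
move=> t_ge0; have t1 : t < t + 1 by rewrite ltrDl.
by apply: le_lt_trans (mu_decr t_ge0 t1); rewrite mu_ge0// addr_ge0.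
Qed.

Lemma mu_is_derive t : 0 < t -> is_derive t 1 mu (mu' t).
Proof. exact: halfline_is_derive. Qed.

Lemma mu_derive_le0 t : 0 < t -> mu' t <= 0.
Proof.
move=> t_gt0; have dc := is_derive1_cvg (mu_is_derive t_gt0).
apply: (limr_le_near (cvg_dnbhs_at_right dc)); near=> h.
have h0 : 0 < h by near: h; exact: nbhs_right_gt.
rewrite -[leLHS]/(h^-1 * _) pmulr_rle0 ?invr_gt0// subr_le0 ltW// mu_decr ?ltrDl//.
exact: ltW.
Unshelve. all: by end_near. Qed.

Lemma f_le_gap t : t0 < t -> f (x t) - f z <= gap t.
Proof.
move=> tt; have m0 : 0 < mu t by rewrite mu_gt0// ltW// (lt_trans t0_gt0).
have /ler_normlP[h _] := smoothing_dist_le smooth kappaP (x t) m0.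
by rewrite /gap; lra.
Qed.

Lemma gap_ge0 t : t0 < t -> 0 <= gap t.
Proof. by move=> /f_le_gap; apply: le_trans; rewrite subr_ge0. Qed.

(** Completing the square in [t *: v t] shows that everything beyond the gap term is nonnegative for
    [lam] between [0] and [alpha - 1]. *)
Lemma energyE lam t : energy lam t = t ^+ 2 * gap t
  + 2^-1 * dot (lam *: (x t - z) + t *: v t) (lam *: (x t - z) + t *: v t)
  + lam * (alpha - 1 - lam) / 2 * dot (x t - z) (x t - z).
Proof.
rewrite /energy; move: (x t - z) => y; rewrite !dotE (dotC (v t) y).
by field.
Qed.

Lemma gap_le_energy lam t : 0 <= lam -> lam <= alpha - 1 ->
  t ^+ 2 * gap t <= energy lam t.
Proof.
move=> lam0 lam1; rewrite energyE -addrA lerDl addr_ge0//.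
  by rewrite mulr_ge0 ?dot_ge0.
by rewrite mulr_ge0 ?dot_ge0// divr_ge0// mulr_ge0// subr_ge0.
Qed.

(** The derivative before the differential equation is used: the acceleration still appears. The
    coefficient [alpha] is [alpha - 1] plus the [1] from differentiating the factor [t]. *)
Definition energy' (lam t : R) : R :=
  2 * t * gap t
  + t ^+ 2 * (dot (grad t) (v t) + mu' t * (derive1 (ft (x t)) (mu t) + kappa))
  + t * dot (v t) (v t) + t ^+ 2 * dot (v t) (halfline_derive t0 v t)
  + lam * (alpha * dot (x t - z) (v t)
           + t * (dot (v t) (v t) + dot (x t - z) (halfline_derive t0 v t))).

Lemma energy_is_derive lam t : t0 < t -> is_derive t 1 (energy lam) (energy' lam t).
Proof.
move=> tt; have t_gt0 : 0 < t by exact: lt_trans tt.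
have [[xC1 vC1] _] := x_traj.
have dx := halfline_is_derive xC1 tt; have dv := halfline_is_derive vC1 tt.
have dmu := mu_is_derive t_gt0.
have dft := smoothing_is_derive dot_norm smooth dx dmu (mu_gt0 (ltW t_gt0)).
have dxz : is_derive t 1 (fun s => x s - z) (v t).
  by apply: is_derive_eq; rewrite subr0.
have dvv := is_derive_dot dot_norm dv dv.
have dxzxz := is_derive_dot dot_norm dxz dxz.
have dxzv := is_derive_dot dot_norm dxz dv.
rewrite /energy /gap; apply: is_derive_eq.
rewrite /energy' /gap /GRing.scale /= (dotC (halfline_derive t0 v t)).
rewrite (dotC (v t) (x t - z)).
by field.
Qed.

Lemma energy'_le lam t : t0 < t -> 2 <= lam -> lam <= alpha - 1 ->
  energy' lam t <= 2 * lam * kappa * (t * mu t).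
Proof.
move=> tt lam2 lama; have t_gt0 : 0 < t by exact: lt_trans tt.
have m0 := mu_gt0 (ltW t_gt0).
have [_ /(_ t (ltW tt))] := x_traj.
set a := halfline_derive t0 v t; set g := grad t => ode.
have {}ode : a = - ((alpha / t) *: v t) - g.
  by apply/eqP; rewrite -subr_eq0 opprD !opprK addrA ode.
have [dft _] := smoothing_C1_space smooth m0.
(* One [kappa * mu t] is the term inside [gap], the other bounds [ft z (mu t) - f z]. *)
have cvx : dot (x t - z) g >= gap t - 2 * kappa * mu t.
  have := convex_gradient_le dot_norm z (smoothing_convex smooth m0) (dft (x t)).
  have /ler_normlP[_ fz] := smoothing_dist_le smooth kappaP z m0.
  by rewrite -(opprB (x t) z) dotNr dotC -/g /gap; lra.
have mu'0 : mu' t * (derive1 (ft (x t)) (mu t) + kappa) <= 0.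
  apply: mulr_le0_ge0; first exact: mu_derive_le0.
  by have /ler_normlP[] := kappaP (x t) m0; lra.
have vv0 := dot_ge0 dot_norm (v t).
have gap0 := gap_ge0 tt.
(* Substituting the acceleration cancels the terms in [dot g (v t)] and [dot (x t - z) (v t)]. *)
have -> : energy' lam t = 2 * t * gap t
    + t ^+ 2 * (mu' t * (derive1 (ft (x t)) (mu t) + kappa))
    - t * (alpha - 1 - lam) * dot (v t) (v t) - lam * t * dot (x t - z) g.
  rewrite /energy' -/a -/g ode !dotBr !dotNr !dotZr (dotC g).
  by field; rewrite gt_eqF.
have e1 : t ^+ 2 * (mu' t * (derive1 (ft (x t)) (mu t) + kappa)) <= 0.
  by rewrite mulr_ge0_le0// exprn_ge0// ltW.
have e2 : 0 <= t * (alpha - 1 - lam) * dot (v t) (v t).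
  by rewrite !mulr_ge0// ?subr_ge0// ltW.
have lt0 : 0 <= lam * t by rewrite mulr_ge0 ?ltW//; lra.
have e3 := ler_wpM2l lt0 cvx.
(* With [cvx], the gap terms add up to [(2 - lam) * t * gap t]; this is where [2 <= lam] enters. *)
have e4 : 0 <= (lam - 2) * (t * gap t) by rewrite mulr_ge0 ?subr_ge0// mulr_ge0// ltW.
move: (t ^+ 2 * _) e1 => A e1.
move: (t * _ * _) e2 => B e2.
move: (dot (x t - z) g) e3 => C e3.
lra.
Qed.

Lemma energy_cvg lam : 2 <= lam -> lam <= alpha - 1 ->
  exists l : R, energy lam t @[t --> +oo] --> l.
Proof.
move=> lam2 lama; have lam0 : 0 <= lam by lra.
have cont t : 0 < t -> {for t, continuous (fun s : R => s * mu s)}.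
  move=> t_gt0; have [dmu _] := mu_is_derive t_gt0.
  have cmu : {for t, continuous mu}.
    by apply: differentiable_continuous; apply/derivable1_diffP.
  exact: cvgM cvg_id cmu.
apply: (@quasi_nonincreasing_is_cvg_pinfty _ (energy lam) (energy' lam)
  (fun t => t * mu t) t0 (2 * lam * kappa)) => //.
- by rewrite !mulr_ge0// ltW.
- by move=> t tt; exact: energy_is_derive.
- by move=> t tt; exact: energy'_le.
- move=> t tt; apply: le_trans (gap_le_energy t lam0 lama).
  by rewrite mulr_ge0 ?sqr_ge0// gap_ge0.
- move=> t tt; have t_ge0 : 0 <= t by apply: le_trans tt; exact: ltW.
  by rewrite mulr_ge0// mu_ge0.
- by move=> t tt; apply: cont; exact: lt_trans tt.
(* Continuity holds on the open half-line, which contains [[t0, +oo[] because [t0 > 0]. *)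
have mo : measurable_fun (`]0, +oo[ : set R) (fun s : R => s * mu s).
  apply: measurable_realfun.open_continuous_measurable_fun => //.
  by move=> t; rewrite inE /= in_itv /= andbT; exact: cont.
apply: measurable_funS mo => //.
by move=> t /=; rewrite !in_itv /= !andbT; exact: lt_le_trans.
Qed.

Lemma dist_argmin_cvg : exists l : R, dot (x t - z) (x t - z) @[t --> +oo] --> l.
Proof.
have a_gt3 := alpha_gt3; have [l2 E2] : exists l : R, energy 2 t @[t --> +oo] --> l.
  by apply: energy_cvg => //; lra.
have [l1 E1] : exists l : R, energy (alpha - 1) t @[t --> +oo] --> l.
  by apply: energy_cvg => //; lra.
have a3 : alpha - 3 != 0 by rewrite gt_eqF// subr_gt0.
have dxz t : t0 < t -> is_derive t 1
    (fun s => 2^-1 * dot (x s - z) (x s - z)) (dot (x t - z) (v t)).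
  move=> tt; have [[xC1 _] _] := x_traj.
  have dx := halfline_is_derive xC1 tt.
  have dxz : is_derive t 1 (fun s => x s - z) (v t).
    by apply: is_derive_eq; rewrite subr0.
  have dxzxz := is_derive_dot dot_norm dxz dxz.
  apply: is_derive_eq; rewrite /GRing.scale /= (dotC (v t)); by field.
(* The energy is affine in [lam], so two values of [lam] isolate its slope; they differ by
   [alpha - 3], which is nonzero. *)
have lim : (alpha - 1) * (2^-1 * dot (x t - z) (x t - z)) + t * dot (x t - z) (v t)
    @[t --> +oo] --> (l1 - l2) / (alpha - 3).
  have -> : (fun t => (alpha - 1) * (2^-1 * dot (x t - z) (x t - z))
      + t * dot (x t - z) (v t)) =
      (fun t => (energy (alpha - 1) t - energy 2 t) / (alpha - 3)).
    by apply/funext => t; rewrite /energy; field.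
  exact: (cvgM (cvgB E1 E2) (cvg_cst _)).
have a1 : 0 < alpha - 1 by lra.
have hl := linear_ode_cvg a1 dxz lim.
exists (2 * ((l1 - l2) / (alpha - 3) / (alpha - 1))).
have -> : (fun t => dot (x t - z) (x t - z)) =
    (fun t => 2 * (2^-1 * dot (x t - z) (x t - z))).
  by apply/funext => t; field.
exact: (cvgM (cvg_cst _) hl).
Qed.

Lemma trajectory_bounded : exists M : R, \forall t \near +oo, `|x t| <= M.
Proof.
have [l xl] := dist_argmin_cvg; exists (`|z| + (l + 2)).
have ll : l < l + 1 by rewrite ltrDl.
near=> t; have : dot (x t - z) (x t - z) <= l + 1 by near: t; exact: (cvgr_le _ xl).
rewrite dot_norm => h.
rewrite -[x t](subrK z) addrC (le_trans (ler_normD _ _))// lerD2l.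
(* With [r] the distance to [z], [r <= 2 * r <= r ^+ 2 + 1 <= l + 2], which avoids a square root. *)
have := sqr_ge0 (`|x t - z| - 1); have := normr_ge0 (x t - z); nra.
Unshelve. all: by end_near. Qed.

Lemma f_trajectory_le e : 0 < e -> \forall t \near +oo, f (x t) <= f z + e.
Proof.
move=> e0; have a_gt3 := alpha_gt3.
have [l El] : exists l : R, energy 2 t @[t --> +oo] --> l.
  by apply: energy_cvg => //; lra.
have ll : l < l + 1 by rewrite ltrDl.
near=> t.
have tt : t0 < t by near: t; apply: nbhs_pinfty_gt; rewrite num_real.
have t1 : 1 <= t by near: t; apply: nbhs_pinfty_ge; rewrite num_real.
have te : (l + 1) / e <= t by near: t; apply: nbhs_pinfty_ge; rewrite num_real.
have El1 : energy 2 t <= l + 1 by near: t; exact: (cvgr_le _ El).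
have lama : 2 <= alpha - 1 by lra.
have gE := gap_le_energy t (ler0n R 2) lama.
have fg := f_le_gap tt; have g0 := gap_ge0 tt.
rewrite ler_pdivrMr// in te.
(* Since [1 <= t], [t * gap t <= t ^+ 2 * gap t <= l + 1 <= t * e]. *)
have tg : t * gap t <= t * e.
  have : t * gap t <= t ^+ 2 * gap t by rewrite ler_wpM2r// expr2 ler_peMl//; lra.
  lra.
have t_gt0 : 0 < t by lra.
by rewrite ler_pM2l// in tg; lra.
Unshelve. all: by end_near. Qed.

(** Weak lower semicontinuity through one smooth approximation at a fixed parameter [m]: its tangent
    inequality at [u] is affine in [x t], so it passes to the weak limit. *)
Lemma weak_cluster_argmin (U : set_system R) (u : H) : ProperFilter U ->
  +oo `<=` U -> (forall h, dot (x t) h @[t --> U] --> dot u h) -> argmin f u.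
Proof.
move=> UU oU xu y; apply: le_trans (z_min y).
apply/ler_addgt0Pr => e e0.
have e2 : 0 < e / 2 by rewrite divr_gt0.
(* The smoothing error [kappa * m = e / 4] is paid twice, at [u] and at [x t]; the other [e / 2]
   bounds [f (x t) - f z]. *)
pose m := e / 4 / kappa.
have m0 : 0 < m by rewrite !divr_gt0.
have km : kappa * m = e / 4 by rewrite /m mulrC divfK// gt_eqF.
have [dft _] := smoothing_C1_space smooth m0.
set g := gradient dot (ft^~ m) u.
have gc : dot (x t) g - dot u g @[t --> U] --> dot u g - dot u g.
  exact: (cvgB (xu g) (cvg_cst _)).
have /ler_normlP[fu _] := smoothing_dist_le smooth kappaP u m0.
have near_le : \forall t \near U, - (f z + e / 2 + kappa * m - ft u m)
    <= - (dot (x t) g - dot u g).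
  apply: oU; apply: filterS (f_trajectory_le e2) => t fx.
  have /ler_normlP[_ fxt] := smoothing_dist_le smooth kappaP (x t) m0.
  have := convex_gradient_le dot_norm (x t) (smoothing_convex smooth m0) (dft u).
  rewrite -/g dotBr !(dotC g) => gx; lra.
have : dot u g - dot u g <= f z + e / 2 + kappa * m - ft u m.
  by apply: (limr_le_near gc); apply: filterS near_le => t; rewrite lerN2.
rewrite subrr; lra.
Qed.

End trajectory_energy.

Theorem theorem3p2 (R : realType) (H : completeNormedModType R)
    (dot : {dot H for idfun}) (dot_norm : induces_norm dot)
    (f : H -> R) (f_convex : convex_function setT f)
    (argmin_f : argmin f !=set0)
    (ft : H -> R -> R) (ft_smoothing : smoothing_function dot f ft)
    (alpha t0 : R) (alpha_gt3 : 3 < alpha) (t0_gt0 : 0 < t0)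
    (mu : R -> R) (mu_ge0 : forall t : R, 0 <= t -> 0 <= mu t)
    (mu_C1 : halfline_C1 0 mu)
    (mu_decr : forall s t : R, 0 <= s -> s < t -> mu t < mu s)
    (mu_cvg0 : mu t @[t --> +oo] --> 0)
    (mu_int : (\int[lebesgue_measure]_(t in `[t0, +oo[) (t * mu t)%:E < +oo)%E)
    (x : R -> H) (x_traj : trajectory dot ft mu alpha t0 x) :
  exists2 xstar : H, argmin f xstar & weakly_cvg_pinfty x xstar.
Proof.
have [z z_min] := argmin_f.
have [kappa kappa0 kappaP] := smoothing_param_bound ft_smoothing.
have [M xM] := trajectory_bounded dot_norm ft_smoothing alpha_gt3 t0_gt0 mu_ge0 mu_C1
  mu_decr mu_int x_traj kappa0 kappaP z_min.
(* The energy argument is run again for each minimiser [y]; boundedness and the cluster points use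
   only the fixed [z]. *)
apply: (opial dot_norm xM) => [y y_min|U u UU oU xu].
  exact: (dist_argmin_cvg dot_norm ft_smoothing alpha_gt3 t0_gt0 mu_ge0 mu_C1
    mu_decr mu_int x_traj kappa0 kappaP y_min).
exact: (weak_cluster_argmin dot_norm ft_smoothing alpha_gt3 t0_gt0 mu_ge0 mu_C1
  mu_decr mu_int x_traj kappa0 kappaP z_min UU oU xu).
Qed.
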